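(* Each of the following classes of matroids is closed under two-sums (i.e. if $\mathcal{L}$ and $\mathcal{M}$ belong to the class and the two-sum $\mathcal{L}\oplus_g\mathcal{M}$ is defined, then $\mathcal{L}\oplus_g\mathcal{M}$ belongs to the class): (a) $\mathbf{B}$-Rayleigh matroids; (b) $\mathbf{I}$-Rayleigh matroids; (c) $\mathbf{S}$-Rayleigh matroids; (d) Potts-Rayleigh matroids.
   Context: For a finite set $E$ and a multiaffine polynomial $Z$ in indeterminates $\mathbf{y}=\{y_e:e\in E\}$ with nonnegative coefficients, not identically zero, let $\Delta Z\{e,f\}=Z_eZ_f-Z_{ef}Z$ where subscripts denote partial derivatives; $Z$ is Rayleigh if $\Delta Z\{e,f\}(\mathbf{y})\ge0$ for all distinct $e,f\in E$ and all $\mathbf{y}$ with all $y_c>0$. For a family $\mathcal{Q}$ of subsets of $E$ let $Z(\mathcal{Q};\mathbf{y})=\sum_{S\in\mathcal{Q}}\prod_{e\in S}y_e$. For a matroid $\mathcal{M}$ on $E$, let $\mathbf{B}\mathcal{M},\mathbf{I}\mathcal{M},\mathbf{S}\mathcal{M}$ be its sets of bases, independent sets and spanning sets; $\mathcal{M}$ is $\mathbf{B}$-Rayleigh (resp. $\mathbf{I}$-, $\mathbf{S}$-Rayleigh) if $Z(\mathbf{B}\mathcal{M};\mathbf{y})$ (resp. $Z(\mathbf{I}\mathcal{M};\mathbf{y})$, $Z(\mathbf{S}\mathcal{M};\mathbf{y})$) is Rayleigh. The Potts model partition function is $Z(\mathcal{M},q;\mathbf{y})=\sum_{S\subseteq E}q^{-\mathrm{rank}_{\mathcal{M}}(S)}\mathbf{y}^S$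 for real $q>0$; $\mathcal{M}$ is Potts-Rayleigh if there is $q_*>0$ such that $Z(\mathcal{M},q;\mathbf{y})$ is Rayleigh for all $0<q\le q_*$. Two-sum: let $\mathcal{L},\mathcal{M}$ be matroids with $E(\mathcal{L})\cap E(\mathcal{M})=\{g\}$, $g$ neither a loop nor a coloop in $\mathcal{L}$ or in $\mathcal{M}$. Then $\mathcal{N}=\mathcal{L}\oplus_g\mathcal{M}$ is the matroid on $E(\mathcal{L})\cup E(\mathcal{M})\setminus\{g\}$ with rank function $\mathrm{rank}_{\mathcal{N}}(S)=\mathrm{rank}_{\mathcal{L}}(S\cap E(\mathcal{L}))+\mathrm{rank}_{\mathcal{M}}(S\cap E(\mathcal{M}))-\nu(S)$, where $\nu(S)=1$ if $g$ lies in the closure (in $\mathcal{L}$) of $S\cap E(\mathcal{L})$ and in the closure (in $\mathcal{M}$) of $S\cap E(\mathcal{M})$, and $\nu(S)=0$ otherwise. *)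

(* Defs.v *)
From HB Require Import structures.
From mathcomp Require Import all_boot all_order all_algebra.
From mathcomp Require Import reals.
Set Implicit Arguments. Unset Strict Implicit. Unset Printing Implicit Defensive.
Import Order.TTheory GRing.Theory Num.Theory.
Local Open Scope ring_scope.

(* All matroids live inside a common finite universe T; a matroid is given by
   its ground set E : {set T} and its rank function r (only values on subsets
   of E matter). *)
Section Matroids.
Variable T : finType.

Definition is_matroid (E : {set T}) (r : {set T} -> nat) : Prop :=
  [/\ (forall X : {set T}, X \subset E -> r X <= #|X|)%N,
      (forall X Y : {set T}, X \subset Y -> Y \subset E -> r X <= r Y)%N &
      (forall X Y : {set T}, X \subset E -> Y \subset E ->
         r (X :|: Y) + r (X :&: Y) <= r X + r Y)%N].

Definition in_closure (r : {set T} -> nat) (X : {set T}) (g : T) : bool :=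
  r (g |: X) == r X.

Definition is_loop (E : {set T}) (r : {set T} -> nat) (g : T) : Prop :=
  g \in E /\ r [set g] = 0%N.

Definition is_coloop (E : {set T}) (r : {set T} -> nat) (g : T) : Prop :=
  g \in E /\ (r (E :\ g) < r E)%N.

Definition indep_sets (E : {set T}) (r : {set T} -> nat) : {set {set T}} :=
  [set S : {set T} | (S \subset E) && (r S == #|S|)].
Definition spanning_sets (E : {set T}) (r : {set T} -> nat) : {set {set T}} :=
  [set S : {set T} | (S \subset E) && (r S == r E)].
Definition bases (E : {set T}) (r : {set T} -> nat) : {set {set T}} :=
  [set S : {set T} | [&& S \subset E, r S == #|S| & r S == r E]].

Definition twosum_ground (EL EM : {set T}) (g : T) : {set T} :=
  (EL :|: EM) :\ g.
Definition twosum_nu (EL EM : {set T}) (rL rM : {set T} -> nat) (g : T)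
  (S : {set T}) : nat :=
  (in_closure rL (S :&: EL) g && in_closure rM (S :&: EM) g : nat).
Definition twosum_rank (EL EM : {set T}) (rL rM : {set T} -> nat) (g : T)
  (S : {set T}) : nat :=
  (rL (S :&: EL) + rM (S :&: EM) - twosum_nu EL EM rL rM g S)%N.

Variable R : realType.

(* A polynomial in indeterminates y_e (e in E) that is multiaffine is given by
   its coefficient function c : {set T} -> R (coefficient of y^S). *)
Definition Zpoly (c : {set T} -> R) (y : T -> R) : R :=
  \sum_(S : {set T}) c S * \prod_(e in S) y e.
Definition Zpoly_d (c : {set T} -> R) (e : T) (y : T -> R) : R :=
  \sum_(S : {set T} | e \in S) c S * \prod_(x in S :\ e) y x.
(* second partial derivative d^2/dy_e dy_f (e <> f) *)
Definition Zpoly_dd (c : {set T} -> R) (e f : T) (y : T -> R) : R :=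
  \sum_(S : {set T} | (e \in S) && (f \in S)) c S * \prod_(x in (S :\ e) :\ f) y x.

Definition DeltaZ (c : {set T} -> R) (e f : T) (y : T -> R) : R :=
  Zpoly_d c e y * Zpoly_d c f y - Zpoly_dd c e f y * Zpoly c y.

Definition is_Rayleigh (E : {set T}) (c : {set T} -> R) : Prop :=
  [/\ forall S : {set T}, c S != 0 -> S \subset E,
      forall S : {set T}, 0 <= c S,
      exists S : {set T}, c S != 0 &
      forall e f : T, e \in E -> f \in E -> e != f ->
        forall y : T -> R, (forall x : T, x \in E -> 0 < y x) ->
          0 <= DeltaZ c e f y].

Definition family_coef (Q : {set {set T}}) (S : {set T}) : R :=
  if S \in Q then 1 else 0.

Definition potts_coef (E : {set T}) (r : {set T} -> nat) (q : R)
  (S : {set T}) : R :=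
  if S \subset E then q ^- (r S) else 0.

Definition B_Rayleigh (E : {set T}) (r : {set T} -> nat) : Prop :=
  is_matroid E r /\ is_Rayleigh E (family_coef (bases E r)).
Definition I_Rayleigh (E : {set T}) (r : {set T} -> nat) : Prop :=
  is_matroid E r /\ is_Rayleigh E (family_coef (indep_sets E r)).
Definition S_Rayleigh (E : {set T}) (r : {set T} -> nat) : Prop :=
  is_matroid E r /\ is_Rayleigh E (family_coef (spanning_sets E r)).
Definition Potts_Rayleigh (E : {set T}) (r : {set T} -> nat) : Prop :=
  is_matroid E r /\
  exists2 qs : R, 0 < qs &
    forall q : R, 0 < q -> q <= qs -> is_Rayleigh E (potts_coef E r q).

End Matroids.

(* Main.v *)
(* Write Z_L = A + y_g B and Z_M = C + y_g D.  In all four cases the two-sum has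
   Z_N = k (A D + B C - lam A C - mu B D) with (k, lam, mu) equal to (1, 0, 0)
   for bases, (1, 0, 1) for independent sets, (1, 1, 0) for spanning sets and
   (q / (1 - q), 1, q) for the Potts polynomial.
   As g is neither a loop nor a coloop, P = D - lam C and Q = C - mu D are
   positive.  For e, f both in L, Z_N = k P Z_L with y_g replaced by Q / P, so
   Delta Z_N{e,f} is a positive multiple of Delta Z_L{e,f}.  For e in L and f in
   M, the Cauchy-Binet identity for the bilinear form Z_N in (A, B) and (C, D)
   gives Delta Z_N{e,f} =
   k^2 (1 - lam mu) Delta Z_L{e,g} Delta Z_M{f,g}. *)
Require Import Defs.
From HB Require Import structures.
From mathcomp Require Import all_boot all_order all_algebra.
From mathcomp Require Import reals.
From mathcomp Require Import zify ring lra.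
Import Order.TTheory GRing.Theory Num.Theory.
Local Open Scope ring_scope.
Set Implicit Arguments.
Unset Strict Implicit.

(** * Multiaffine polynomials: point values, differences and generating functions *)

Section Polynomials.
Context {T : finType} {R : realType}.
Implicit Types (X Y S : {set T}) (c d : {set T} -> R) (y z : T -> R).
Implicit Types (F : (T -> R) -> R).

Definition upd y e v : T -> R := fun x => if x == e then v else y x.

(** Keeping only the subsets of [X] makes the value independent of variables outside [X]. The
    polynomials A, B of the left matroid and C, D of the right one have this shape, free of y_g. *)
Definition genf X c y : R :=
  \sum_(S : {set T} | S \subset X) c S * \prod_(x in S) y x.

(* For a multiaffine polynomial F this is the partial derivative in y_e. *)
Definition diff e F y : R := F (upd y e 1) - F (upd y e 0).

(** Written with values of [F] instead of coefficients, so that substituting for y_g becomes a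
    pointwise rewriting. *)
Definition Delta F e f y : R :=
  diff e F y * diff f F y - diff e (diff f F) y * F y.

Lemma eq_genf X c y z : {in X, y =1 z} -> genf X c y = genf X c z.
Proof.
move=> yz; apply: eq_bigr => S sSX; congr (_ * _).
by apply: eq_bigr => x xS; apply/yz/(subsetP sSX).
Qed.

Lemma genf_upd X c y e v : e \notin X -> genf X c (upd y e v) = genf X c y.
Proof.
by move=> eX; apply: eq_genf => x xX; rewrite /upd; case: eqP => // xe;
   rewrite -xe xX in eX.
Qed.

Lemma upd_upd y e f a b x : e != f ->
  upd (upd y e a) f b x = upd (upd y f b) e a x.
Proof.
rewrite /upd => ef; case: (eqVneq x f) => [->|//].
by rewrite eq_sym (negPf ef).
Qed.

Lemma eq_Zpoly c y z : y =1 z -> Zpoly c y = Zpoly c z.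
Proof.
move=> yz; apply: eq_bigr => S _; congr (_ * _).
by apply: eq_bigr => x _.
Qed.

Lemma prod_upd (P : {set T}) y e (v : R) : e \in P ->
  \prod_(x in P) upd y e v x = v * \prod_(x in P :\ e) y x.
Proof.
move=> eP; rewrite (big_setD1 e) //= /upd eqxx; congr (_ * _).
by apply: eq_bigr => x; rewrite !inE => /andP[/negPf->].
Qed.

Lemma prod_upd_notin (P : {set T}) y e (v : R) : e \notin P ->
  \prod_(x in P) upd y e v x = \prod_(x in P) y x.
Proof.
move=> eP; apply: eq_bigr => x xP; rewrite /upd; case: eqP => // xe.
by rewrite -xe xP in eP.
Qed.

Lemma Zpoly_dE c e y : Zpoly_d c e y = diff e (Zpoly c) y.
Proof.
rewrite /diff /Zpoly -sumrB [RHS](bigID (fun S : {set T} => e \in S)) /=.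
rewrite [X in _ + X]big1 ?addr0; last first.
  by move=> S eS; rewrite !prod_upd_notin // subrr.
by apply: eq_bigr => S eS; rewrite !prod_upd // mul1r mul0r mulr0 subr0.
Qed.

Lemma Zpoly_ddE c e f y : e != f ->
  Zpoly_dd c e f y = diff e (diff f (Zpoly c)) y.
Proof.
move=> ef; rewrite {1}/diff -!Zpoly_dE /Zpoly_d -sumrB.
rewrite [RHS](bigID (fun S : {set T} => e \in S)) /=.
rewrite [X in _ + X]big1 ?addr0; last first.
  move=> S /andP[fS eS].
  by rewrite !prod_upd_notin ?subrr // !inE (negPf eS) andbF.
rewrite (eq_bigl _ _ (fun S => andbC (f \in S) (e \in S))).
apply: eq_bigr => S /andP[eS fS].
have eSf : e \in S :\ f by rewrite !inE ef.
rewrite !prod_upd // mul1r mul0r mulr0 subr0.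
by congr (_ * _); apply: eq_bigl => x; rewrite !inE andbCA.
Qed.

Lemma DeltaZE c e f y : e != f -> DeltaZ c e f y = Delta (Zpoly c) e f y.
Proof. by move=> ef; rewrite /DeltaZ Zpoly_ddE // !Zpoly_dE. Qed.

Lemma DeltaZC c e f y : DeltaZ c e f y = DeltaZ c f e y.
Proof.
rewrite /DeltaZ mulrC; congr (_ - _ * _); apply: eq_big => S.
  by rewrite andbC.
move=> _; congr (_ * _); apply: eq_bigl => x.
by rewrite !inE andbCA.
Qed.

Lemma Zpoly_genf X c y : (forall S : {set T}, c S != 0 -> S \subset X) ->
  Zpoly c y = genf X c y.
Proof.
move=> sup; rewrite /Zpoly (bigID (fun S : {set T} => S \subset X)) /=.
rewrite [X in _ + X]big1 ?addr0 // => S nSX.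
have [->|/sup SX] := eqVneq (c S) 0; first by rewrite mul0r.
by rewrite SX in nSX.
Qed.

Lemma genf_setU1 X c g y : g \notin X ->
  genf (g |: X) c y = genf X c y + y g * genf X (fun S : {set T} => c (g |: S)) y.
Proof.
move=> gX; rewrite /genf (bigID (fun S : {set T} => g \notin S)) /=.
congr (_ + _).
  apply: eq_bigl => S; apply/andP/idP.
    case=> SgX gS; apply/subsetP => x xS.
    have := subsetP SgX x xS; rewrite !inE => /orP[/eqP xg|//].
    by rewrite xg (negPf gS) in xS.
  move=> SX; split; first by apply: subset_trans SX _; apply: subsetUr.
  by apply: contra gX; apply/subsetP.
rewrite (reindex_onto (fun S => g |: S) (fun S => S :\ g)) /=; last first.
  by move=> S /andP[_]; rewrite negbK => /setD1K.
rewrite mulr_sumr; apply: eq_big => S.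
  rewrite setU11 /= andbT; apply/andP/idP.
    case=> SgX /eqP <-; apply/subsetP => x; rewrite !inE => /andP[/negPf xg].
    by rewrite xg /= => /(subsetP (subset_trans (subsetUr _ _) SgX));
       rewrite !inE xg.
  move=> SX; split; first exact: setUS.
  by rewrite setU1K //; apply: contra gX; apply/subsetP.
case/andP=> /andP[_ _] /eqP <-.
have gS : g \notin (g |: S) :\ g by rewrite !inE eqxx.
by rewrite big_setU1 //= mulrCA.
Qed.

(** By disjointness, subsets of the union correspond bijectively to pairs of their traces on [X] and
    [Y], and each monomial factors accordingly. *)
Lemma genfM X Y c d y : [disjoint X & Y] ->
  genf X c y * genf Y d y =
  genf (X :|: Y) (fun S : {set T} => c (S :&: X) * d (S :&: Y)) y.
Proof.
move=> dXY; rewrite /genf big_distrlr pair_big /=.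
rewrite (reindex_onto (fun S => (S :&: X, S :&: Y)) (fun p => p.1 :|: p.2)) /=.
  apply: eq_big => S.
    rewrite !subsetIr /= -setIUr; apply/eqP/idP => [<-|]; first exact: subsetIr.
    by move/setIidPl.
  case/andP=> _ /eqP SE.
  rewrite mulrACA; congr (_ * _).
  rewrite -[in RHS]SE [RHS](big_setID (S :&: X)) /=.
  congr (_ * _); apply: eq_bigl => x; rewrite !inE.
    by case: (x \in S); case: (x \in X); rewrite ?andbF.
  have := disjointFr dXY (x:=x).
  by case: (x \in S); case: (x \in X) => //= ->.
move=> [A B] /= /andP[AX BY]; congr (_, _); rewrite setIUl.
  rewrite (setIidPl AX); apply/setUidPl/subsetP => x; rewrite !inE.
  by case/andP=> /(subsetP BY) xY; rewrite (disjointFl dXY xY).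
rewrite (setIidPl BY); apply/setUidPr/subsetP => x; rewrite !inE.
by case/andP=> /(subsetP AX) xX; rewrite (disjointFr dXY xX).
Qed.

Lemma genfZ X (k : R) c y : genf X (fun S : {set T} => k * c S) y = k * genf X c y.
Proof. by rewrite /genf mulr_sumr; apply: eq_bigr => S _; rewrite mulrA. Qed.

Lemma genfD X c d y : genf X (fun S : {set T} => c S + d S) y = genf X c y + genf X d y.
Proof. by rewrite /genf -big_split; apply: eq_bigr => S _; rewrite mulrDl. Qed.

Lemma genfB X c d y : genf X (fun S : {set T} => c S - d S) y = genf X c y - genf X d y.
Proof. by rewrite /genf -sumrB; apply: eq_bigr => S _; rewrite mulrBl. Qed.

Lemma genf_gt0 X c y :
  (forall S : {set T}, S \subset X -> 0 <= c S) ->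
  (exists2 S : {set T}, S \subset X & 0 < c S) ->
  (forall x, x \in X -> 0 < y x) -> 0 < genf X c y.
Proof.
move=> c0 [S SX cS] y0.
have p0 (U : {set T}) : U \subset X -> 0 < \prod_(x in U) y x.
  by move=> UX; apply: prodr_gt0 => x xU; apply/y0/(subsetP UX).
rewrite /genf (bigD1 S) //= ltr_pwDl ?mulr_gt0 ?p0 //.
by apply: sumr_ge0 => U /andP[UX _]; rewrite mulr_ge0 ?c0 ?ltW ?p0.
Qed.

End Polynomials.

(** * Rayleigh criterion for a glued polynomial *)

Section Gluing.
Context {T : finType} {R : realType}.
Implicit Types (X Y S : {set T}) (c : {set T} -> R) (y : T -> R).

(** Coefficientwise source of P > 0 and Q > 0: both polynomials have nonnegative coefficients, and
    each has a positive one. *)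
Definition dominated X g c (lam mu : R) : Prop :=
  [/\ forall S : {set T}, S \subset X -> lam * c S <= c (g |: S),
      forall S : {set T}, S \subset X -> mu * c (g |: S) <= c S,
      exists2 S : {set T}, S \subset X & lam * c S < c (g |: S) &
      exists2 S : {set T}, S \subset X & mu * c (g |: S) < c S].

(** The formula for Z_N read off at the monomial of [S]; the four products come from AD, BC, AC and
    BD. *)
Definition glued X Y g cX cY cN (k lam mu : R) : Prop :=
  forall S : {set T}, S \subset X :|: Y ->
  cN S = k * (cX (S :&: X) * cY (g |: S :&: Y)
              + cX (g |: S :&: X) * cY (S :&: Y)
              - lam * (cX (S :&: X) * cY (S :&: Y))
              - mu * (cX (g |: S :&: X) * cY (g |: S :&: Y))).

Lemma gluedC X Y g cX cY cN k lam mu :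
  glued X Y g cX cY cN k lam mu -> glued Y X g cY cX cN k lam mu.
Proof. by move=> h S; rewrite setUC => /h ->; ring. Qed.

Lemma dominated_gt0 X g c lam mu y : dominated X g c lam mu ->
  (forall x, x \in X -> 0 < y x) ->
  0 < genf X (fun S : {set T} => c (g |: S)) y - lam * genf X c y /\
  0 < genf X c y - mu * genf X (fun S : {set T} => c (g |: S)) y.
Proof.
move=> [h1 h2 [S1 s1 e1] [S2 s2 e2]] y0; rewrite -!genfZ -!genfB.
split; apply: genf_gt0 => //.
- by move=> S /h1; rewrite subr_ge0.
- by exists S1; rewrite ?subr_gt0.
- by move=> S /h2; rewrite subr_ge0.
- by exists S2; rewrite ?subr_gt0.
Qed.

Section Polynomial.
Variables (X Y : {set T}) (g : T) (cX cY cN : {set T} -> R) (k lam mu : R).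
Hypotheses (gX : g \notin X) (gY : g \notin Y) (dXY : [disjoint X & Y]).
Hypothesis sX : forall S : {set T}, cX S != 0 -> S \subset g |: X.
Hypothesis sY : forall S : {set T}, cY S != 0 -> S \subset g |: Y.
Hypothesis sN : forall S : {set T}, cN S != 0 -> S \subset X :|: Y.
Hypothesis cNE : glued X Y g cX cY cN k lam mu.

Let A := genf X cX.
Let B := genf X (fun S : {set T} => cX (g |: S)).
Let C := genf Y cY.
Let D := genf Y (fun S : {set T} => cY (g |: S)).

Lemma glued_Zpoly y : Zpoly cN y =
  k * (A y * D y + B y * C y - lam * (A y * C y) - mu * (B y * D y)).
Proof.
rewrite (Zpoly_genf _ sN) /A /B /C /D !genfM // -!genfZ -genfD -!genfB -genfZ.
by apply: eq_bigr => S SXY; rewrite (cNE SXY).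
Qed.

Lemma ZpolyX y : Zpoly cX y = A y + y g * B y.
Proof. by rewrite (Zpoly_genf _ sX) genf_setU1. Qed.

Lemma ZpolyY y : Zpoly cY y = C y + y g * D y.
Proof. by rewrite (Zpoly_genf _ sY) genf_setU1. Qed.

Lemma Delta_glued_same e f y : e \in X -> f \in X -> e != f ->
  D y - lam * C y != 0 ->
  DeltaZ cN e f y = (k * (D y - lam * C y)) ^+ 2 *
    DeltaZ cX e f (upd y g ((C y - mu * D y) / (D y - lam * C y))).
Proof.
move=> eX fX ef P0.
set P := D y - _ in P0 *; set t := _ / P.
have [eg fg] : e != g /\ f != g.
  by split; [apply: contraNneq gX => <-|apply: contraNneq gX => <-].
have [eY fY] : e \notin Y /\ f \notin Y by rewrite !(disjointFr dXY).
(* AD + BC - lam AC - mu BD = AP + BQ = P (A + t B) with t = Q / P. As e and f lie outside [Y],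
   changing y_e and y_f keeps C, D, hence P and t, fixed, so the factorization holds at every point
   occurring in [Delta]. *)
have sc z : C z = C y -> D z = D y ->
    Zpoly cN z = k * P * Zpoly cX (upd z g t).
  move=> Cz Dz; rewrite glued_Zpoly ZpolyX Cz Dz.
  have -> : upd z g t g = t by rewrite /upd eqxx.
  rewrite /A /B !genf_upd // -/(A z) -/(B z) /t; move: P0; rewrite /P => P0.
  by field.
rewrite !DeltaZE // /Delta /diff.
rewrite ?sc /C /D ?genf_upd //.
have u2 a b : Zpoly cX (upd (upd (upd y e a) f b) g t) =
              Zpoly cX (upd (upd (upd y g t) e a) f b).
  apply: eq_Zpoly => x; rewrite upd_upd // /upd.
  by case: eqP => // _; case: eqP => [->|//]; rewrite eq_sym (negPf eg).
have u1 a h : h != g ->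
   Zpoly cX (upd (upd y h a) g t) = Zpoly cX (upd (upd y g t) h a).
  by move=> hg; apply: eq_Zpoly => x; rewrite upd_upd.
rewrite !u2 !u1 //; ring.
Qed.

Lemma Delta_glued_cross e f y : e \in X -> f \in Y ->
  DeltaZ cN e f y =
  k ^+ 2 * (1 - lam * mu) * DeltaZ cX e g y * DeltaZ cY f g y.
Proof.
move=> eX fY.
have ef : e != f.
  by apply: contraTneq eX => ->; rewrite (disjointFl dXY fY).
have [eg fg] : e != g /\ f != g.
  by split; [apply: contraNneq gX => <-|apply: contraNneq gY => <-].
have [eY fX] : e \notin Y /\ f \notin X.
  by rewrite (disjointFr dXY) ?(disjointFl dXY fY).
(* Only A, B react to y_e and only C, D to y_f, so everything becomes a polynomial identity in their
   values at y and at 0 and 1 in that variable. The factor 1 - lam mu is, up to sign, the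
   determinant of the bilinear form with rows (-lam, 1) and (1, -mu). *)
rewrite !DeltaZE // /Delta /diff !glued_Zpoly !ZpolyX !ZpolyY.
have u2 c z a b : genf Y c (upd (upd z e a) f b) = genf Y c (upd z f b).
  rewrite -[RHS](genf_upd _ _ a eY); apply: eq_genf => x _.
  by rewrite upd_upd.
rewrite /C /D !u2 !(genf_upd _ _ _ eY, genf_upd _ _ _ gY).
rewrite /A /B !(genf_upd _ _ _ gX, genf_upd _ _ _ fX).
have ug z v : upd z g v g = v by rewrite /upd eqxx.
have uh z h v : h != g -> upd z h v g = z g.
  by rewrite /upd eq_sym => /negPf ->.
rewrite !ug !uh //.
ring.
Qed.

End Polynomial.

(** Allows y_g to be reset freely in the glued polynomial, in which it does not occur. *)
Lemma DeltaZ_eq c e f X y z : (forall S : {set T}, c S != 0 -> S \subset X) -> e != f ->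
  {in X, y =1 z} -> DeltaZ c e f y = DeltaZ c e f z.
Proof.
move=> sX ef yz; rewrite !DeltaZE // /Delta /diff !(Zpoly_genf _ sX).
have E a b : {in X, upd (upd y e a) f b =1 upd (upd z e a) f b}.
  by move=> x xX; rewrite /upd; do 2 case: eqP => // _; rewrite yz.
have E1 h a : {in X, upd y h a =1 upd z h a}.
  by move=> x xX; rewrite /upd; case: eqP => // _; rewrite yz.
by rewrite !(eq_genf _ (E _ _)) !(eq_genf _ (E1 _ _)) (eq_genf _ yz).
Qed.

Lemma glued_Rayleigh X Y g cX cY (cN : {set T} -> R) (k lam mu : R) :
  g \notin X -> g \notin Y -> [disjoint X & Y] ->
  0 < k -> 0 <= lam -> 0 <= mu -> lam * mu <= 1 ->
  dominated X g cX lam mu -> dominated Y g cY lam mu ->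
  (forall S : {set T}, cN S != 0 -> S \subset X :|: Y) ->
  (forall S, 0 <= cN S) ->
  glued X Y g cX cY cN k lam mu ->
  is_Rayleigh (g |: X) cX -> is_Rayleigh (g |: Y) cY ->
  is_Rayleigh (X :|: Y) cN.
Proof.
move=> gX gY dXY k0 lam0 mu0 lm domX domY sN cN0 cNE RX RY.
have [sX _ _ rX] := RX; have [sY _ _ rY] := RY.
split=> //.
  have y0 (U : {set T}) (x : T) : x \in U -> 0 < (fun=> 1 : R) x by [].
  have [pX qX] := dominated_gt0 domX (y0 X).
  have [pY qY] := dominated_gt0 domY (y0 Y).
  (* A nonzero coefficient is obtained from positivity at the all-ones point: the value is k (AP +
     BQ) with A >= 0, B > lam A >= 0, P > 0 and Q > 0. *)
  have : 0 < Zpoly cN (fun=> 1).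
    rewrite (glued_Zpoly dXY sN cNE).
    set A := genf X cX _ in pX qX *; set B := genf X _ _ in pX qX *.
    set C := genf Y cY _ in pY qY *; set D := genf Y _ _ in pY qY *.
    have A0 : 0 <= A.
      apply: sumr_ge0 => S SX; rewrite mulr_ge0 //; first by case: RX.
      by rewrite prodr_ge0.
    have B0 : 0 < B by have := mulr_ge0 lam0 A0; lra.
    rewrite mulr_gt0 //; nra.
  case: (pickP (fun S : {set T} => cN S != 0)) => [S cS _|z]; first by exists S.
  rewrite /Zpoly big1 ?ltxx // => S _; have /negbFE/eqP -> := z S.
  by rewrite mul0r.
(* Stated for an arbitrary ordered pair of sides, so that it covers both elements in [X] and,
   through [gluedC], both in [Y]. *)
have same (X' Y' : {set T}) (cX' cY' : {set T} -> R) :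
    g \notin X' -> g \notin Y' -> [disjoint X' & Y'] ->
    (forall S : {set T}, cN S != 0 -> S \subset X' :|: Y') ->
    glued X' Y' g cX' cY' cN k lam mu ->
    dominated Y' g cY' lam mu -> is_Rayleigh (g |: X') cX' ->
    forall e f, e \in X' -> f \in X' -> e != f ->
    forall y, (forall x, x \in X' :|: Y' -> 0 < y x) -> 0 <= DeltaZ cN e f y.
  move=> gX' gY' d' s' g' dY' [sX' _ _ rX'] e f eX fX ef y y0.
  have y0Y x : x \in Y' -> 0 < y x by move=> xY; rewrite y0 // inE xY orbT.
  have [pY qY] := dominated_gt0 dY' y0Y.
  rewrite (Delta_glued_same gX' d' sX' s' g') ?gt_eqF //.
  rewrite mulr_ge0 ?sqr_ge0 // rX' ?setU1r // => x; rewrite !inE /upd.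
  case: eqP => [_ _|_ /= xX]; first by rewrite divr_gt0.
  by apply: y0; rewrite inE xX.
have cross e f : e \in X -> f \in Y -> forall y,
    (forall x, x \in X :|: Y -> 0 < y x) -> 0 <= DeltaZ cN e f y.
  move=> eX fY y y0.
  have ef : e != f by apply: contraTneq eX => ->; rewrite (disjointFl dXY fY).
  have [eg fg] : e != g /\ f != g.
    by split; [apply: contraNneq gX => <-|apply: contraNneq gY => <-].
  (* The sign of y_g is unknown, while the Rayleigh hypotheses on the two sides require it positive;
     hence the value 1. *)
  rewrite (DeltaZ_eq (X := X :|: Y) (z := upd y g 1)) //; last first.
    move=> x xXY; rewrite /upd; case: eqP => // xg.
    by rewrite xg inE (negPf gX) (negPf gY) in xXY.
  rewrite (Delta_glued_cross gX gY dXY sX sY sN cNE) //.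
  apply: mulr_ge0; first apply: mulr_ge0.
    by rewrite mulr_ge0 ?subr_ge0 // sqr_ge0.
    apply: rX; rewrite ?setU11 ?setU1r // => x; rewrite !inE /upd.
    by case: eqP => //= _ xX; rewrite y0 // inE xX.
  apply: rY; rewrite ?setU11 ?setU1r // => x; rewrite !inE /upd.
  by case: eqP => //= _ xY; rewrite y0 // inE xY orbT.
move=> e f; rewrite !inE => eXY fXY ef y y0.
have y0' x : x \in Y :|: X -> 0 < y x by rewrite setUC; apply: y0.
case/orP: eXY => eX; case/orP: fXY => fX.
- exact: (same X Y cX cY).
- exact: cross.
- by rewrite DeltaZC; apply: cross.
- apply: (same Y X cY cX) => //; first by rewrite disjoint_sym.
    by move=> S; rewrite setUC; apply: sN.
  exact: gluedC.
Qed.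

End Gluing.

(** * Rank functions: closure and extension of independent sets *)

Section Matroid.
Context {T : finType}.
Implicit Types (E X Y S : {set T}) (r : {set T} -> nat).
Local Open Scope nat_scope.

Lemma rank_set0 E r : is_matroid E r -> r set0 = 0.
Proof.
by case=> card _ _; apply/eqP; rewrite -leqn0 -(cards0 T) card ?sub0set.
Qed.

Lemma rank_setU1 E r S x : is_matroid E r -> S \subset E -> x \in E ->
  r S <= r (x |: S) <= (r S).+1.
Proof.
move=> [card mono subm] SE xE.
have x1E : [set x] \subset E by rewrite sub1set.
rewrite mono ?subsetUr ?subUset ?x1E //=.
have := subm _ _ x1E SE; have := card _ x1E; rewrite cards1; lia.
Qed.

(** Take [W] maximal between [S] and [Y] with the rank of [S]. For x in [Y], submodularity on [W]
    and [x |: S], whose intersection contains [S], shows that adding x to [W] keeps the rank, so [W]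
    already contains x. *)
Lemma rank_closed E r S Y : is_matroid E r -> S \subset Y -> Y \subset E ->
  (forall x, x \in Y -> r (x |: S) = r S) -> r Y = r S.
Proof.
move=> [card mono subm] SY YE cl.
pose P := [pred W : {set T} | [&& S \subset W, W \subset Y & r W == r S]].
have PS : P S by rewrite /= subxx SY eqxx.
have [W] := maxset_exists (P := P) PS.
case/maxsetP=> /and3P[SW WY /eqP rW] maxW _.
suff WE : W = Y by rewrite -WE.
apply/eqP; rewrite eqEsubset WY; apply/subsetP => x xY.
suff <- : x |: W = W by rewrite setU11.
apply: maxW; last exact: subsetUr.
have xWY : x |: W \subset Y by rewrite subUset sub1set xY.
rewrite /= xWY (subset_trans SW (subsetUr _ _)) eqn_leq.
have xSY : x |: S \subset Y by rewrite subUset sub1set xY SY.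
have := subm W (x |: S) (subset_trans WY YE) (subset_trans xSY YE).
have -> : W :|: (x |: S) = x |: W.
  by rewrite setUCA (setUidPl SW).
have I1 : r S <= r (W :&: (x |: S)).
  apply: mono; first by rewrite subsetI SW subsetUr.
  by rewrite subIset ?(subset_trans WY YE).
have := mono S (x |: W) (subset_trans SW (subsetUr _ _)) (subset_trans xWY YE).
rewrite cl //; lia.
Qed.

(** A maximal independent [B] works: an element of [Y] raising its rank could be added, so none
    does, and [rank_closed] applies. *)
Lemma indep_extension E r S Y : is_matroid E r -> S \subset Y -> Y \subset E ->
  r S = #|S| ->
  exists B : {set T}, [/\ S \subset B, B \subset Y, r B = #|B| & r B = r Y].
Proof.
move=> mat SY YE rS; have [card mono _] := mat.
pose P := [pred W : {set T} | (W \subset Y) && (r W == #|W|)].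
have PS : P S by rewrite /= SY rS eqxx.
have [B /maxsetP[/andP[BY /eqP rB] maxB] SB] := maxset_exists (P := P) PS.
exists B; split=> //; symmetry; apply: (rank_closed mat) => // x xY.
have [xB|xB] := boolP (x \in B); first by rewrite (setUidPr _) ?sub1set.
have BE := subset_trans BY YE.
have := rank_setU1 mat BE (subsetP YE x xY).
have [->//|ne] := eqVneq (r (x |: B)) (r B) => h.
suff xBB : x |: B = B by rewrite -xBB setU11 in xB.
apply: maxB; last exact: subsetUr.
rewrite /= subUset sub1set xY BY /= cardsU1 xB -rB; apply/eqP.
move: h ne; lia.
Qed.

End Matroid.

(** * Coefficient inequalities at an element that is neither a loop nor a coloop *)

Section Element.
Context {T : finType} {R : realType}.
Variables (X : {set T}) (g : T) (r : {set T} -> nat).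
Hypotheses (gX : g \notin X) (mat : is_matroid (g |: X) r).
Hypotheses (rg : r [set g] = 1%N) (rX : r X = r (g |: X)).
Implicit Types S : {set T}.

Lemma rank_facts S : S \subset X ->
  [/\ (r S <= r (g |: S) <= (r S).+1)%N, (0 < r (g |: S) <= r X)%N,
      (r S <= #|S|)%N & #|g |: S| = #|S|.+1].
Proof.
move=> SX; have SE : S \subset g |: X := subset_trans SX (subsetUr _ _).
have gSE : g |: S \subset g |: X by apply: setUS.
have [card mono _] := mat; split; first 1 last.
- by rewrite rX mono // andbT -rg mono // subsetUl.
- exact: card.
- by rewrite cardsU1 (contra (subsetP SX g) gX).
- by apply: (rank_setU1 mat); rewrite ?setU11.
Qed.

Lemma setU1_sub S : S \subset X -> g |: S \subset g |: X.
Proof. exact: setUS. Qed.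

Lemma sub_setU1 S : S \subset X -> S \subset g |: X.
Proof. by move=> h; apply: subset_trans h (subsetUr _ _). Qed.

Lemma basis_avoiding : exists2 S : {set T}, S \subset X & r S = #|S| /\ r S = r X.
Proof.
have r0 : r set0 = #|@set0 T| by rewrite cards0 (rank_set0 mat).
have [B [_ BX rB rBX]] := indep_extension mat (sub0set X) (subsetUr _ _) r0.
by exists B.
Qed.

(** Extend the independent set [[set g]] to a basis and remove g. With [basis_avoiding] this
    provides sets at which inequalities of [dominated] are strict. *)
Lemma basis_through :
  exists2 S : {set T}, S \subset X & r (g |: S) = #|S|.+1 /\ r (g |: S) = r X.
Proof.
have r1 : r [set g] = #|[set g]| by rewrite cards1.
have [B [gB BE rB rBE]] := indep_extension mat (subsetUl _ _) (subxx _) r1.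
rewrite sub1set in gB; exists (B :\ g).
  apply/subsetP => x; rewrite !inE => /andP[/negPf xg xB].
  by have := subsetP BE x xB; rewrite !inE xg.
by rewrite setD1K // rBE rX -rBE rB (cardsD1 g) gB.
Qed.

Lemma bases_dominated :
  dominated X g (family_coef R (bases (g |: X) r)) 0 0.
Proof.
have [B1 B1X [rB1 rB1X]] := basis_avoiding.
have [B2 B2X [rB2 rB2X]] := basis_through.
split; [| |exists B2|exists B1] => // [S SX|S SX||]; rewrite mul0r /family_coef.
- by case: ifP.
- by case: ifP.
- rewrite inE setU1_sub // -rX rB2X eqxx andbT -rB2X rB2.
  by have [_ _ _ ->] := rank_facts B2X; rewrite eqxx ltr01.
- by rewrite inE sub_setU1 // -rX rB1 -rB1X rB1 eqxx ltr01.
Qed.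

(** Here mu = 1 because independence passes to subsets; it is strict at a basis avoiding g, which
    becomes dependent when g is added. *)
Lemma indep_dominated :
  dominated X g (family_coef R (indep_sets (g |: X) r)) 0 1.
Proof.
have [B1 B1X [rB1 rB1X]] := basis_avoiding.
split; [| |exists set0|exists B1] => // [S SX|S SX|||];
  rewrite ?mul0r ?mul1r ?sub0set // /family_coef.
- by case: ifP.
- have [h1 _ h3 h4] := rank_facts SX.
  rewrite !inE setU1_sub ?sub_setU1 //= h4.
  case: eqP => h5; case: eqP => h6 //=; exfalso; lia.
- by rewrite inE setU0 sub1set setU11 rg cards1 ltr01.
- have [h1 h2 h3 h4] := rank_facts B1X.
  rewrite !inE setU1_sub ?sub_setU1 //= h4 rB1 eqxx.
  case: eqP => h5; rewrite ?ltr01 //; exfalso; lia.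
Qed.

(** Dually, lam = 1 because spanning passes to supersets; it is strict at a basis through g with g
    removed, which is too small to span. *)
Lemma spanning_dominated :
  dominated X g (family_coef R (spanning_sets (g |: X) r)) 1 0.
Proof.
have [B2 B2X [rB2 rB2X]] := basis_through.
split; [| |exists B2|exists X] => // [S SX|S SX||];
  rewrite ?mul0r ?mul1r // /family_coef.
- have [h1 h2 _ _] := rank_facts SX.
  rewrite !inE setU1_sub ?sub_setU1 //= -rX.
  case: eqP => h5; case: eqP => h6 //=; exfalso; lia.
- by case: ifP.
- have [h1 h2 h3 h4] := rank_facts B2X.
  rewrite !inE setU1_sub ?sub_setU1 //= -rX rB2X eqxx.
  case: eqP => h5; rewrite ?ltr01 //; exfalso; lia.
- by rewrite inE sub_setU1 // -rX eqxx ltr01.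
Qed.

(** Adding g raises the rank by 0 or 1, so it multiplies the coefficient by 1 or 1/q. The rank does
    rise at the empty set and does not rise at [X], which gives the two strict inequalities. *)
Lemma potts_dominated (q : R) : 0 < q -> q < 1 ->
  dominated X g (potts_coef (g |: X) r q) 1 q.
Proof.
move=> q0 q1.
have p0 n : 0 < q ^- n by rewrite invr_gt0 exprn_gt0.
have pS n : q ^- n.+1 = q^-1 * q ^- n by rewrite exprS invfM.
have qV1 : 1 < q^-1 by rewrite invf_gt1.
have qVq : q * q^-1 = 1 by rewrite mulfV ?gt_eqF.
have E (S : {set T}) : S \subset X ->
  potts_coef (g |: X) r q S = q ^- r S /\
  potts_coef (g |: X) r q (g |: S) = q ^- r (g |: S).
  by move=> SX; rewrite /potts_coef setU1_sub ?sub_setU1.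
have E2 (S : {set T}) : S \subset X -> r (g |: S) = r S \/ r (g |: S) = (r S).+1.
  by move=> /rank_facts[h1 _ _ _]; lia.
split; [| |exists set0|exists X] => // [S SX|S SX|||].
- have [-> ->] := E _ SX; have := p0 (r S).
  by case: (E2 _ SX) => -> h; rewrite ?pS mul1r // ler_peMl // ltW.
- have [-> ->] := E _ SX; have := p0 (r S).
  case: (E2 _ SX) => -> h; rewrite ?pS; first by rewrite ler_piMl // ltW.
  by rewrite mulrA qVq mul1r.
- exact: sub0set.
- have [-> ->] := E _ (sub0set X).
  by rewrite setU0 rg (rank_set0 mat) expr0 expr1 invr1 mulr1.
- by have [-> ->] := E _ (subxx X); rewrite -rX (gtr_pMl _ (p0 _)).
Qed.

End Element.

(** * Two-sums: matroid axioms and the four gluing formulas *)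

Section TwoSum.
Context {T : finType} {R : realType}.
Variables (X Y : {set T}) (g : T) (rL rM : {set T} -> nat).
Hypotheses (gX : g \notin X) (gY : g \notin Y) (dXY : [disjoint X & Y]).
Hypotheses (mL : is_matroid (g |: X) rL) (mM : is_matroid (g |: Y) rM).
Hypotheses (rLg : rL [set g] = 1%N) (rLX : rL X = rL (g |: X)).
Hypotheses (rMg : rM [set g] = 1%N) (rMY : rM Y = rM (g |: Y)).
Implicit Types S U : {set T}.

Let rN := twosum_rank (g |: X) (g |: Y) rL rM g.

Lemma setI_U1 S Z : g \notin S -> S :&: (g |: Z) = S :&: Z.
Proof.
move=> gS; rewrite setIUr [S :&: [set g]]disjoint_setI0 ?set0U //.
by rewrite disjoint_sym disjoints1.
Qed.

Lemma notin_sub S : S \subset X :|: Y -> g \notin S.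
Proof.
by move=> SXY; apply: contra (subsetP SXY g) _; rewrite inE negb_or gX.
Qed.

Lemma twosum_rankE S : S \subset X :|: Y ->
  rN S = (rL (S :&: X) + rM (S :&: Y) -
   ((rL (g |: S :&: X) == rL (S :&: X)) &&
    (rM (g |: S :&: Y) == rM (S :&: Y))))%N.
Proof.
move=> SXY; have gS := notin_sub SXY.
by rewrite /rN /twosum_rank /twosum_nu /in_closure !setI_U1.
Qed.

(* Both terms of the minimum are submodular, and so are mixed pairs, since
   (g |: V) :&: W = V :&: W when g is not in W; hence twosum_matroid. *)
Lemma twosum_rank_min S : S \subset X :|: Y ->
  (rN S).+1 = minn (rL (S :&: X) + rM (S :&: Y)).+1
                   (rL (g |: S :&: X) + rM (g |: S :&: Y)).
Proof.
move=> SXY; rewrite twosum_rankE //.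
have [h1 h2 _ _] := rank_facts gX mL rLg rLX (subsetIr S X).
have [k1 k2 _ _] := rank_facts gY mM rMg rMY (subsetIr S Y).
(* The natural subtraction of nu never truncates: when g is in both closures, each side already has
   positive rank since g is not a loop. *)
case: eqP => /= h; [case: eqP => /= k|]; lia.
Qed.

Lemma card_split S : S \subset X :|: Y -> #|S| = (#|S :&: X| + #|S :&: Y|)%N.
Proof.
move=> SXY; rewrite -(cardsID X S); congr (_ + _)%N; apply: eq_card => x.
rewrite !inE; case xS : (x \in S); rewrite ?andbF //= andbT.
have := subsetP SXY x xS; rewrite inE; case xX : (x \in X) => //=.
by rewrite (disjointFr dXY xX).
Qed.

Lemma twosum_matroid : is_matroid (X :|: Y) rN.
Proof.
have subL (S : {set T}) : S :&: X \subset g |: X.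
  exact: subset_trans (subsetIr _ _) (subsetUr _ _).
have subM (S : {set T}) : S :&: Y \subset g |: Y.
  exact: subset_trans (subsetIr _ _) (subsetUr _ _).
have subLg (S : {set T}) : g |: S :&: X \subset g |: X by rewrite setUS ?subsetIr.
have subMg (S : {set T}) : g |: S :&: Y \subset g |: Y by rewrite setUS ?subsetIr.
have [cL oL sL] := mL; have [cM oM sM] := mM.
split.
- move=> S SXY; have := twosum_rank_min SXY; rewrite card_split //.
  have := cL _ (subL S); have := cM _ (subM S); lia.
- move=> S U SU UXY.
  have := twosum_rank_min UXY; have := twosum_rank_min (subset_trans SU UXY).
  have := oL _ _ (setSI X SU) (subL _); have := oM _ _ (setSI Y SU) (subM _).
  have := oL _ _ (setUS [set g] (setSI X SU)) (subLg _).
  have := oM _ _ (setUS [set g] (setSI Y SU)) (subMg _).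
  lia.
move=> S U SXY UXY.
have SUXY : S :|: U \subset X :|: Y by rewrite subUset SXY.
have IXY : S :&: U \subset X :|: Y by rewrite subIset ?SXY.
have := twosum_rank_min SXY; have := twosum_rank_min UXY.
have := twosum_rank_min SUXY; have := twosum_rank_min IXY.
have IE (Z : {set T}) : (S :&: U) :&: Z = (S :&: Z) :&: (U :&: Z).
  by rewrite setIACA setIid.
rewrite !IE ![(S :|: U) :&: _]setIUl.
have gg (Z : {set T}) : (g |: S :&: Z) :|: (g |: U :&: Z) = g |: ((S :&: Z) :|: (U :&: Z)).
  by rewrite setUACA setUid.
have gi (Z : {set T}) : (g |: S :&: Z) :&: (g |: U :&: Z) = g |: ((S :&: Z) :&: (U :&: Z)).
  by rewrite -setUIr.
have gl (V W : {set T}) : g \notin W -> (g |: V) :&: W = V :&: W.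
  by move=> gW; rewrite setIC setI_U1 // setIC.
have nI (V Z : {set T}) : g \notin Z -> g \notin V :&: Z.
  by move=> gZ; rewrite inE negb_and gZ orbT.
have gu (Z : {set T}) : (g |: S :&: Z) :|: (U :&: Z) = g |: ((S :&: Z) :|: (U :&: Z)).
  by rewrite setUA.
have ug (Z : {set T}) : (S :&: Z) :|: (g |: U :&: Z) = g |: ((S :&: Z) :|: (U :&: Z)).
  by rewrite setUCA.
(* One pair of inequalities for each choice of the term attaining the minimum at [S] and at [U]:
   four choices, the last two mixed. *)
have := sL _ _ (subL S) (subL U); have := sM _ _ (subM S) (subM U).
have := sL _ _ (subLg S) (subLg U); have := sM _ _ (subMg S) (subMg U).
have := sL _ _ (subLg S) (subL U); have := sM _ _ (subMg S) (subM U).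
have := sL _ _ (subL S) (subLg U); have := sM _ _ (subM S) (subMg U).
rewrite !gg !gi !gu !ug !gl ?nI // !setI_U1 ?nI //.
lia.
Qed.

Lemma twosum_rank_ground : (rN (X :|: Y)).+1 = (rL X + rM Y)%N.
Proof.
rewrite twosum_rank_min // !setIUl !setIid (setIC Y X).
rewrite (disjoint_setI0 dXY) setU0 set0U -rLX -rMY; lia.
Qed.

Lemma family_coefE (Q : {set {set T}}) S : family_coef R Q S = (S \in Q)%:R.
Proof. by rewrite /family_coef; case: ifP. Qed.

(** A basis of the two-sum is a basis avoiding g on one side and a basis through g, with g removed,
    on the other. The trace sizes decide which side is which, so the two products are never both
    1. *)
Lemma bases_glued :
  glued X Y g (family_coef R (bases (g |: X) rL))
    (family_coef R (bases (g |: Y) rM)) (family_coef R (bases (X :|: Y) rN))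
    1 0 0.
Proof.
move=> S SXY; rewrite !family_coefE !inE.
rewrite SXY !setU1_sub ?sub_setU1 ?subsetIr //= -rLX -rMY.
have := twosum_rank_min SXY; have := twosum_rank_ground; rewrite card_split //.
have [h1 h2 h3 ->] := rank_facts gX mL rLg rLX (subsetIr S X).
have [k1 k2 k3 ->] := rank_facts gY mM rMg rMY (subsetIr S Y).
move=> e1 e2; rewrite !mul0r !subr0 mul1r -!natrM !mulnb -natrD.
congr (_%:R); lia.
Qed.

(** A set is independent in the two-sum when both traces are independent and at least one stays so
    after adding g. Inclusion-exclusion over that alternative subtracts BD. *)
Lemma indep_glued :
  glued X Y g (family_coef R (indep_sets (g |: X) rL))
    (family_coef R (indep_sets (g |: Y) rM))
    (family_coef R (indep_sets (X :|: Y) rN)) 1 0 1.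
Proof.
move=> S SXY; rewrite !family_coefE !inE.
rewrite SXY !setU1_sub ?sub_setU1 ?subsetIr //=.
have := twosum_rank_min SXY; rewrite card_split //.
have [h1 h2 h3 ->] := rank_facts gX mL rLg rLX (subsetIr S X).
have [k1 k2 k3 ->] := rank_facts gY mM rMg rMY (subsetIr S Y).
move=> e; rewrite mul0r subr0 !mul1r -!natrM !mulnb -natrD.
apply/eqP; rewrite eq_sym subr_eq -natrD; apply/eqP; congr (_%:R); lia.
Qed.

(** A set spans the two-sum when both traces span after adding g and at least one spans without it.
    Inclusion-exclusion subtracts AC. *)
Lemma spanning_glued :
  glued X Y g (family_coef R (spanning_sets (g |: X) rL))
    (family_coef R (spanning_sets (g |: Y) rM))
    (family_coef R (spanning_sets (X :|: Y) rN)) 1 1 0.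
Proof.
move=> S SXY; rewrite !family_coefE !inE.
rewrite SXY !setU1_sub ?sub_setU1 ?subsetIr //= -rLX -rMY.
have := twosum_rank_min SXY; have := twosum_rank_ground.
have [h1 h2 h3 _] := rank_facts gX mL rLg rLX (subsetIr S X).
have [k1 k2 k3 _] := rank_facts gY mM rMg rMY (subsetIr S Y).
move=> e1 e2; rewrite mul0r subr0 !mul1r -!natrM !mulnb -natrD.
apply/eqP; rewrite eq_sym subr_eq -natrD; apply/eqP; congr (_%:R); lia.
Qed.

Lemma potts_glued (q : R) : 0 < q -> q < 1 ->
  glued X Y g (potts_coef (g |: X) rL q) (potts_coef (g |: Y) rM q)
    (potts_coef (X :|: Y) rN q) (q / (1 - q)) 1 q.
Proof.
move=> q0 q1 S SXY; rewrite /potts_coef.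
rewrite SXY !setU1_sub ?sub_setU1 ?subsetIr //=.
have qn0 : q != 0 by rewrite gt_eqF.
have qd0 : 1 - q != 0 by rewrite subr_eq0 gt_eqF.
have := twosum_rank_min SXY.
have [h1 h2 _ _] := rank_facts gX mL rLg rLX (subsetIr S X).
have [k1 k2 _ _] := rank_facts gY mM rMg rMY (subsetIr S Y).
move: h1 h2 k1 k2.
move: (rN S) (rL (g |: _)) (rL _) (rM (g |: _)) (rM _) => n a' a b' b.
move=> h1 h2 k1 k2 e.
(* Relative to the product of the coefficients of the two traces, the bracket is 1 - q if g raises
   the rank on neither side and (1 - q) / q otherwise. The factor q / (1 - q) turns these into q and
   1, matching a rank drop of 1 and 0. *)
have [aa|aa] : a' = a \/ a' = a.+1 by lia.
  have [bb|bb] : b' = b \/ b' = b.+1 by lia.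
    (* The left rank is positive as g is not a loop, so the exponent a + b - 1 can be written
       without subtraction. *)
    case: a h1 h2 e aa => [|a] h1 h2 e aa; first by exfalso; lia.
    have -> : n = (a + b)%N by lia.
    rewrite aa bb exprD exprS; field.
    by rewrite qd0 qn0 !expf_neq0.
  have -> : n = (a + b)%N by lia.
  rewrite aa bb exprD exprS; field.
  by rewrite qd0 qn0 !expf_neq0.
have [bb|bb] : b' = b \/ b' = b.+1 by lia.
  have -> : n = (a + b)%N by lia.
  rewrite aa bb exprD exprS; field.
  by rewrite qd0 qn0 !expf_neq0.
have -> : n = (a + b)%N by lia.
rewrite aa bb exprD !exprS; field.
by rewrite qd0 qn0 !expf_neq0.
Qed.

End TwoSum.

(** * Reduction of the theorem to the gluing criterion *)

Lemma nonloop_rank (T : finType) (E : {set T}) r g : is_matroid E r ->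
  g \in E -> ~ is_loop E r g -> r [set g] = 1%N.
Proof.
move=> [card _ _] gE nl; have := card [set g]; rewrite sub1set gE cards1.
move/(_ isT); case rg : (r [set g]) => [|[|n]] //.
by case: nl.
Qed.

Lemma noncoloop_rank (T : finType) (E : {set T}) r g : is_matroid E r ->
  g \in E -> ~ is_coloop E r g -> r (E :\ g) = r E.
Proof.
move=> [_ mono _] gE nc; apply/eqP; rewrite eqn_leq mono ?subsetDl // leqNgt.
by apply/negP => h; apply: nc.
Qed.

Unset Implicit Arguments.
Set Strict Implicit.

Theorem theorem5p8 (T : finType) (R : realType)
  (EL EM : {set T}) (rL rM : {set T} -> nat) (g : T) :
  is_matroid EL rL -> is_matroid EM rM ->
  EL :&: EM = [set g] ->
  ~ is_loop EL rL g -> ~ is_coloop EL rL g ->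
  ~ is_loop EM rM g -> ~ is_coloop EM rM g ->
  let EN := twosum_ground EL EM g in
  let rN := twosum_rank EL EM rL rM g in
  [/\ B_Rayleigh R EL rL -> B_Rayleigh R EM rM -> B_Rayleigh R EN rN,
      I_Rayleigh R EL rL -> I_Rayleigh R EM rM -> I_Rayleigh R EN rN,
      S_Rayleigh R EL rL -> S_Rayleigh R EM rM -> S_Rayleigh R EN rN &
      Potts_Rayleigh R EL rL -> Potts_Rayleigh R EM rM -> Potts_Rayleigh R EN rN].
Proof.
move=> mL mM ELM nlL ncL nlM ncM EN rN.
have /andP[gL gM] : (g \in EL) && (g \in EM) by rewrite -in_setI ELM set11.
pose X := EL :\ g; pose Y := EM :\ g.
have EX : g |: X = EL by rewrite setD1K.
have EY : g |: Y = EM by rewrite setD1K.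
have gX : g \notin X by rewrite !inE eqxx.
have gY : g \notin Y by rewrite !inE eqxx.
have dXY : [disjoint X & Y].
  by rewrite -setI_eq0 -setDIl ELM setDv.
have ENE : EN = X :|: Y by rewrite /EN /twosum_ground setDUl.
have rLg := nonloop_rank mL gL nlL; have rMg := nonloop_rank mM gM nlM.
have rLX : rL X = rL (g |: X) by rewrite EX; apply: noncoloop_rank.
have rMY : rM Y = rM (g |: Y) by rewrite EY; apply: noncoloop_rank.
rewrite {}/rN {}ENE; move: mL mM; rewrite -EX -EY => mL mM.
have mN := twosum_matroid gX gY dXY mL mM rLg rLX rMg rMY.
have glue := glued_Rayleigh gX gY dXY.
have fsup (E : {set T}) (Q : {set {set T}}) : (forall S, S \in Q -> S \subset E) ->
    forall S, family_coef R Q S != 0 -> S \subset E.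
  by move=> sub S; rewrite /family_coef; case: ifP; rewrite ?eqxx // => /sub.
have fge0 (Q : {set {set T}}) (S : {set T}) : 0 <= family_coef R Q S by rewrite /family_coef; case: ifP.
split.
- move=> [_ RL] [_ RM]; split=> //.
  apply: (glue R _ _ _ 1 0 0 _ _ _ _ _ _ _ _ _ RL RM); rewrite ?mulr0 ?ler01 ?ltr01 //.
  + exact: bases_dominated.
  + exact: bases_dominated.
  + by apply: fsup => S; rewrite inE => /and3P[].
  + exact: bases_glued.
- move=> [_ RL] [_ RM]; split=> //.
  apply: (glue R _ _ _ 1 0 1 _ _ _ _ _ _ _ _ _ RL RM); rewrite ?mul0r ?ler01 ?ltr01 //.
  + exact: indep_dominated.
  + exact: indep_dominated.
  + by apply: fsup => S; rewrite inE => /andP[].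
  + exact: indep_glued.
- move=> [_ RL] [_ RM]; split=> //.
  apply: (glue R _ _ _ 1 1 0 _ _ _ _ _ _ _ _ _ RL RM); rewrite ?mulr0 ?ler01 ?ltr01 //.
  + exact: spanning_dominated.
  + exact: spanning_dominated.
  + by apply: fsup => S; rewrite inE => /andP[].
  + exact: spanning_glued.
move=> [_ [qL qL0 RL]] [_ [qM qM0 RM]]; split=> //.
(* The bound 1/2 keeps q below 1, so that q / (1 - q) is positive and [potts_dominated] applies. *)
exists (Num.min (2^-1) (Num.min qL qM)).
  by rewrite !lt_min invr_gt0 ltr0n qL0.
move=> q q0; rewrite !le_min => /and3P[q2 /(RL _ q0) {}RL /(RM _ q0) {}RM].
have q1 : q < 1 by lra.
apply: (glue R _ _ _ (q / (1 - q)) 1 q _ _ _ _ _ _ _ _ _ RL RM);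
  rewrite ?mul1r ?ler01 ?(ltW q0) ?(ltW q1) //.
- by rewrite divr_gt0 // subr_gt0.
- exact: potts_dominated.
- exact: potts_dominated.
- by move=> S; rewrite /potts_coef; case: ifP; rewrite ?eqxx.
- move=> S; rewrite /potts_coef; case: ifP => // _.
  by rewrite invr_ge0 exprn_ge0 // ltW.
- exact: potts_glued.
Qed.
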